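(* Let $L$ be a locale. The following statements are equivalent. (1) Every non-void nowhere dense sublocale of $L$ is maximal nowhere dense. (2) Every non-void closed nowhere dense sublocale of $L$ is maximal nowhere dense. (3) Every non-void open sublocale $\mathfrak{o}(x)$ of $L$ induced by a non-complemented element $x\in L$ has a boundary which is maximal nowhere dense in $L$. (4) Every non-void closed nowhere dense sublocale of $L$ is homogeneous maximal nowhere dense. (5) Every non-void closed nowhere dense sublocale $F$ of $L$ is almost inaccessible as a sublocale of $L$ with respect to itself, i.e. $F$ is almost $F$-inaccessible. (6) Every non-void closed nowhere dense sublocale $F$ of $L$ is inaccessible as a sublocale of $L$ with respect to itself, i.e. $F$ is $F$-inaccessible.
   Context: A locale is a complete lattice in which finite meets distribute over arbitrary joins. $\mathcal{S}(L)$ is the set of sublocales of $L$ ordered by inclusion (meets are intersections); $\mathsf{O}=\{1\}$ is the void sublocale. $\mathfrak{c}(a)=\{x\in L: a\le x\}$ and $\mathfrak{o}(a)=\{a\to x: x\in L\}$ are the closed and open sublocales induced by $a$. $\overline{S}$ is the closure and $\mathrm{int}(S)$ the interior of $S$ (largest open sublocale contained in $S$); $\mathrm{cl}_S$ denotes closure computed in the locale $S$. $L\smallsetminus S$ is the supplement of $S$: the smallest $T\in\mathcal{S}(L)$ with $S\vee T=L$. The boundary of $S$ is $\overline{S}\smallsetminus\mathrm{int}(S)=\overline{S}\cap(L\smallsetminus\mathrm{int}(S))$. An element $x$ is complemented if $x\vee x^*=1$, $x^*=x\to 0$. A sublocale $N$ of $L$ is nowhere dense if $N\cap\mathfrak{B}L=\mathsf{O}$,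 where $\mathfrak{B}L=\{x\to 0:x\in L\}$ is the smallest dense sublocale. For $S\in\mathcal{S}(L)$, ''$N$ is nowhere dense in $S$'' (or $S$-nowhere dense) means $N\subseteq S$ and $N$ is a nowhere dense sublocale of the locale $S$. A nowhere dense sublocale $N$ of $L$ is maximal nowhere dense if there is no nowhere dense sublocale $S$ of $L$ such that $N$ is nowhere dense in $S$. A regular-closed sublocale of a locale is one that is the closure of some open sublocale; ''$N$-regular-closed'' means regular-closed in the locale $N$. A closed nowhere dense sublocale $N$ of $L$ is homogeneous maximal nowhere dense if each non-void $N$-regular-closed sublocale is maximal nowhere dense in $L$. For $S\in\mathcal{S}(L)$, a sublocale $T\subseteq S$ is $S$-inaccessible (resp. almost $S$-inaccessible) if for every $(L\smallsetminus S)$-nowhere dense sublocale $N$ one has $T\cap\overline{N}=\mathsf{O}$ (resp. $T\subseteq\mathrm{cl}_S(S\cap(L\smallsetminus\overline{N}))$), with $\overline{N}$ the closure in $L$. *)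

(* Defs.v *)
From HB Require Import structures.
From mathcomp Require Import all_boot all_order.
From mathcomp Require Import boolp classical_sets.

Set Implicit Arguments.
Unset Strict Implicit.
Unset Printing Implicit Defensive.

Import Order.TTheory.

Local Open Scope order_scope.
Local Open Scope classical_set_scope.

HB.mixin Record TBLattice_isLocale d (T : Type) of Order.TBLattice d T := {
  sup : set T -> T;
  sup_supremums : forall A : set T, supremums A (sup A);
  meet_supr : forall (x : T) (A : set T),
    Order.meet x (sup A) = sup [set Order.meet x a | a in A]
}.

#[short(type="localeType")]
HB.structure Definition Locale d :=
  { T of Order.TBLattice d T & TBLattice_isLocale d T }.

Section LocaleTheory.
Context {d : Order.disp_t} {L : localeType d}.
Implicit Types (x y z : L) (A : set L).

Definition inf A : L := sup (lbound A).

Definition himp x y : L := sup [set z | Order.meet z x <= y].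

Definition pcompl x : L := himp x \bot.

Definition complemented x := Order.join x (pcompl x) = \top.

Lemma sup_ub A x : A x -> x <= sup A.
Proof. by move=> Ax; case: (sup_supremums A) => + _; apply. Qed.

Lemma sup_le A x : ubound A x -> sup A <= x.
Proof. by move=> Ax; case: (sup_supremums A) => _; apply. Qed.

Lemma inf_lb A x : A x -> inf A <= x.
Proof. by move=> Ax; apply: sup_le => y; apply. Qed.

Lemma inf_ge A x : lbound A x -> x <= inf A.
Proof. by move=> Ax; apply: sup_ub. Qed.

Lemma himpP x y z : (z <= himp x y) = (Order.meet z x <= y).
Proof.
apply/idP/idP => [zxy|]; last by move=> zxy; apply: sup_ub.
apply: le_trans (leI2 zxy (lexx x)) _.
rewrite meetC meet_supr; apply: sup_le => _ [w wxy <-].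
by rewrite meetC.
Qed.

End LocaleTheory.

Record sublocale d (L : localeType d) := Sublocale {
  sl_set :> set L;
  sl_inf : forall A : set L, A `<=` sl_set -> sl_set (inf A);
  sl_himp : forall x s : L, sl_set s -> sl_set (himp x s)
}.

Section Sublocales.
Context {d : Order.disp_t} {L : localeType d}.
Implicit Types (S T : sublocale L) (F : set (sublocale L)) (x a : L).

Lemma sl_top S : sl_set S \top.
Proof.
suff <- : inf set0 = \top :> L by apply: sl_inf.
by apply/le_anti; rewrite lex1 inf_ge.
Qed.

Lemma bigcap_inf F (A : set L) :
  A `<=` \bigcap_(S in F) sl_set S -> (\bigcap_(S in F) sl_set S) (inf A).
Proof. by move=> AF S FS; apply: sl_inf => x /AF; apply. Qed.

Lemma bigcap_himp F x (s : L) :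
  (\bigcap_(S in F) sl_set S) s -> (\bigcap_(S in F) sl_set S) (himp x s).
Proof. by move=> Fs S FS; apply/sl_himp/Fs. Qed.

Definition sl_bigmeet F : sublocale L :=
  Sublocale (@bigcap_inf F) (@bigcap_himp F).

Definition sl_bigjoin F : sublocale L :=
  sl_bigmeet [set T | forall S, F S -> S `<=` T].

Definition sl_meet S T : sublocale L :=
  sl_bigmeet [set U | (U : set L) = S \/ (U : set L) = T].

Definition sl_join S T : sublocale L :=
  sl_bigmeet [set U | S `<=` U /\ T `<=` U].

(* [\top] is the unit $1$ of $L$, so this is $S = \mathsf{O}$. *)
Definition is_void S := (S : set L) = [set \top].

Lemma closed_inf a (A : set L) :
  A `<=` [set x | a <= x] -> [set x | a <= x] (inf A).
Proof. by move=> Aa; apply: inf_ge => x /Aa. Qed.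

Lemma closed_himp a x s : [set x | a <= x] s -> [set x | a <= x] (himp x s).
Proof. by move=> /= le_as; rewrite himpP (le_trans _ le_as)// leIl. Qed.

Definition sl_closed a : sublocale L :=
  Sublocale (@closed_inf a) (@closed_himp a).

Lemma open_inf a (A : set L) :
  A `<=` [set himp a x | x in [set: L]] ->
  [set himp a x | x in [set: L]] (inf A).
Proof.
move=> Aa; exists (inf A) => //; apply/le_anti/andP; split; last first.
  by rewrite himpP leIl.
apply: inf_ge => b Ab; have [y _ eb] := Aa _ Ab.
rewrite -eb himpP -{2}(meetxx a) meetA -himpP eb.
apply: le_trans (inf_lb Ab).
by rewrite -himpP.
Qed.

Lemma open_himp a x s :
  [set himp a x | x in [set: L]] s ->
  [set himp a x | x in [set: L]] (himp x s).
Proof.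
move=> [y _ <-]; exists (himp x y) => //.
suff swap u v : himp u (himp v y) <= himp v (himp u y).
  by apply/le_anti; rewrite !swap.
by rewrite himpP himpP meetAC -himpP -himpP.
Qed.

Definition sl_open a : sublocale L :=
  Sublocale (@open_inf a) (@open_himp a).

Definition is_closed S := exists a, (S : set L) = sl_closed a.

Definition is_open S := exists a, (S : set L) = sl_open a.

Definition sl_closure S : sublocale L :=
  sl_bigmeet [set C | is_closed C /\ S `<=` C].

Definition sl_interior S : sublocale L :=
  sl_bigjoin [set O | is_open O /\ O `<=` S].

Definition sl_supplement S : sublocale L :=
  sl_bigmeet [set T | (sl_join S T : set L) = [set: L]].

Lemma sl_meetE S T : (sl_meet S T : set L) = S `&` T.
Proof.
apply/seteqP; split=> [x STx|x [Sx Tx] U [] ->] //.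
by split; [apply: (STx S); left|apply: (STx T); right].
Qed.

(* [sl_closureE], [sl_interiorE] and [sl_join_supplement] show that closures
   are closed, interiors are open and supplements join with [S] to [L], so the
   extremal sublocales defined above by meets and joins are attained. *)
Lemma sl_closureE S : (sl_closure S : set L) = sl_closed (inf S).
Proof.
apply/seteqP; split=> [x Sx|x /= Sx _ [[a ->] Sa]].
  by apply: (Sx (sl_closed _)); split; [exists (inf S)|move=> y /inf_lb].
by apply: le_trans Sx; apply: inf_ge => y /Sa.
Qed.

Lemma sl_interiorE S :
  (sl_interior S : set L) = sl_open (sup [set a | sl_open a `<=` S]).
Proof.
set a := sup _; apply/seteqP; split=> [x Sx|_ [y _ <-] U SU].
  apply: (Sx (sl_open a)) => O [[b ->] bS] _ [y _ <-]; exists (himp b y) => //.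
  have /meet_idPl ba : b <= a by apply: sup_ub => z /bS.
  apply/le_anti/andP; split; last by rewrite himpP leIl.
  by rewrite himpP -{2}ba (meetC b a) meetA -!himpP.
suff -> : himp a y = inf [set himp b y | b in [set b | sl_open b `<=` S]].
  apply: sl_inf => _ [b bS <-].
  have : sl_open b `<=` U by apply: SU; split=> //; exists b.
  by apply; exists y.
apply/le_anti/andP; split.
  apply: inf_ge => _ [b bS <-]; rewrite himpP.
  by apply: le_trans (leI2 (lexx _) (sup_ub bS)) _; rewrite -himpP.
rewrite himpP meet_supr; apply: sup_le => _ [b bS <-].
by rewrite -himpP inf_lb//; exists b.
Qed.

Lemma sl_joinP S T x :
  sl_set (sl_join S T) x <->
  exists s t, [/\ sl_set S s, sl_set T t & x = Order.meet s t].
Proof.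
split=> [|[s [t [Ss Tt ->]]] U [SU TU]]; last first.
  suff -> : Order.meet s t = inf [set s; t].
    by apply: sl_inf => _ [] ->; [apply: SU|apply: TU].
  apply/le_anti/andP; split.
    by apply: inf_ge => _ [] ->; rewrite ?leIl ?leIr.
  by rewrite lexI !inf_lb//=; [right|left].
pose U := [set x | exists s t, [/\ sl_set S s, sl_set T t & x = Order.meet s t]].
have U_inf (A : set L) : A `<=` U -> U (inf A).
  move=> AU; exists (inf [set s | sl_set S s /\ inf A <= s]).
  exists (inf [set t | sl_set T t /\ inf A <= t]).
  split; try by apply: sl_inf => z [].
  apply/le_anti/andP; split; first by rewrite lexI !inf_ge// => z [].
  apply: inf_ge => a Aa; have [s [t [Ss Tt aE]]] := AU _ Aa.
  have := inf_lb Aa; rewrite aE lexI => /andP[sa ta].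
  by apply: leI2; apply: inf_lb.
have U_himp y z : U z -> U (himp y z).
  move=> [s [t [Ss Tt ->]]]; exists (himp y s), (himp y t).
  split; try exact: sl_himp.
  apply/le_anti/andP; split.
    rewrite lexI !himpP; apply/andP; split.
      by apply: le_trans (leIl s t); rewrite -himpP.
    by apply: le_trans (leIr t s); rewrite -himpP.
  by rewrite himpP lexI; apply/andP; split; rewrite -himpP ?leIl ?leIr.
move=> /(_ (Sublocale U_inf U_himp)); apply; split=> z Sz.
  by exists z, \top; split=> //; rewrite ?meetx1//; apply: sl_top.
by exists \top, z; split=> //; rewrite ?meet1x//; apply: sl_top.
Qed.

Lemma sl_join_supplement S : (sl_join S (sl_supplement S) : set L) = setT.
Proof.
apply/seteqP; split=> // x _; apply/sl_joinP.
pose s := inf [set y | sl_set S y /\ x <= y].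
have xs : x <= s by apply: inf_ge => y [].
exists s, (himp s x); split; first by apply: sl_inf => y [].
  move=> T /seteqP[_ /(_ x I)] /sl_joinP[s' [t [Ss' Tt xE]]].
  have ss' : s <= s' by apply: inf_lb; split=> //; rewrite xE leIl.
  suff -> : himp s x = himp s t by apply: sl_himp.
  apply/le_anti/andP; split; rewrite himpP.
    by apply: (@le_trans _ _ x); [rewrite -himpP|rewrite xE leIr].
  by rewrite xE lexI (le_trans (leIr _ _) ss')/= -himpP.
by apply/le_anti; rewrite lexI xs himpP leIl/= meetC -himpP.
Qed.

Definition sl_boundary S : sublocale L :=
  sl_meet (sl_closure S) (sl_supplement (sl_interior S)).

(* The carrier of the least dense sublocale $\mathfrak{B}L$. *)
Definition booleanization : set L := [set pcompl x | x in [set: L]].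

Definition nowhere_dense S := S `&` booleanization = [set \top].

Definition regular_closed S :=
  exists2 O, is_open O & (S : set L) = sl_closure O.

End Sublocales.

(* A sublocale is a locale for the order inherited from [L]. *)
Definition sl_type d (L : localeType d) (S : sublocale L) : Type :=
  {x : L | x \in sl_set S}.

Section SublocaleLocale.
Context {d : Order.disp_t} {L : localeType d} (S : sublocale L).

HB.instance Definition _ := SubChoice.on (sl_type S).
HB.instance Definition _ := [SubChoice_isSubPOrder of sl_type S by <: with d].
Implicit Types (x y z : sl_type S) (A : set (sl_type S)).

Lemma sl_leE x y : (x <= y) = (val x <= val y).
Proof. by []. Qed.

Lemma sl_valP x : sl_set S (val x).
Proof. by apply/set_mem/valP. Qed.

Definition sl_elt (a : L) (Sa : sl_set S a) : sl_type S :=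
  exist _ a (mem_set Sa).

Lemma setI_inf (P : set L) : sl_set S (inf (S `&` P)).
Proof. by apply: sl_inf => x []. Qed.

Definition sl_refl (P : set L) : sl_type S := sl_elt (setI_inf P).

Lemma sl_meet_subproof x y : sl_set S (Order.meet (val x) (val y)).
Proof.
suff -> : Order.meet (val x) (val y) = inf [set val x; val y].
  by apply: sl_inf => _ [] ->; apply: sl_valP.
apply/le_anti/andP; split.
  by apply: inf_ge => _ [] ->; rewrite (leIl, leIr).
by rewrite lexI !inf_lb//=; [right|left].
Qed.

Definition slt_meet x y := sl_elt (sl_meet_subproof x y).
Definition slt_join x y := sl_refl [set z | val x <= z /\ val y <= z].
Definition slt_bot := sl_refl setT.
Definition slt_top := sl_elt (sl_top S).
Definition slt_sup A := sl_refl (ubound [set val x | x in A]).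

Lemma slt_meetP x y z : (x <= slt_meet y z) = (x <= y) && (x <= z).
Proof. by rewrite !sl_leE/= lexI. Qed.

Lemma slt_joinP x y z : (slt_join x y <= z) = (x <= z) && (y <= z).
Proof.
rewrite !sl_leE/=; apply/idP/idP => [h|/andP[xz yz]].
  by apply/andP; split; apply: le_trans h; apply: inf_ge => w [_ []].
by apply: inf_lb; split => //; apply: sl_valP.
Qed.

HB.instance Definition _ :=
  Order.POrder_MeetJoin_isLattice.Build d (sl_type S) slt_meetP slt_joinP.

Lemma slt_le0x x : slt_bot <= x.
Proof. by rewrite sl_leE; apply: inf_lb; split => //; apply: sl_valP. Qed.

Lemma slt_lex1 x : x <= slt_top.
Proof. by rewrite sl_leE lex1. Qed.

HB.instance Definition _ := Order.hasBottom.Build d (sl_type S) slt_le0x.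
HB.instance Definition _ := Order.hasTop.Build d (sl_type S) slt_lex1.

Lemma slt_sup_supremums A : supremums A (slt_sup A).
Proof.
split=> [x Ax|x Ax]; rewrite sl_leE.
  by apply: inf_ge => y [_]; apply; exists x.
by apply: inf_lb; split=> [|_ [y /Ax + <-]]; [apply: sl_valP|rewrite sl_leE].
Qed.

Lemma slt_meet_supr x A :
  Order.meet x (slt_sup A) = slt_sup [set Order.meet x a | a in A].
Proof.
apply/le_anti/andP; split; last first.
  case: (slt_sup_supremums [set Order.meet x a | a in A]) => _; apply.
  move=> _ [a Aa <-]; apply: leI2 => //.
  by case: (slt_sup_supremums A) => + _; apply.
rewrite sl_leE/=; apply: inf_ge => z [Sz Az].
rewrite meetC -himpP; apply: inf_lb; split; first exact: sl_himp.
move=> _ [a Aa <-]; rewrite himpP meetC; apply: Az.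
by exists (Order.meet x a) => //; exists a.
Qed.

HB.instance Definition _ :=
  TBLattice_isLocale.Build d (sl_type S) slt_sup_supremums slt_meet_supr.

Lemma val_inf A : val (inf A) = inf [set val x | x in A].
Proof.
apply/le_anti/andP; split.
  by apply: inf_ge => _ [x Ax <-]; rewrite -sl_leE inf_lb.
have SA : sl_set S (inf [set val x | x in A]).
  by apply: sl_inf => _ [x _ <-]; apply: sl_valP.
rewrite -[X in X <= _]/(val (sl_elt SA)) -sl_leE.
by apply: inf_ge => x Ax; rewrite sl_leE/= inf_lb//; exists x.
Qed.

Lemma val_himp x y : val (himp x y) = himp (val x) (val y).
Proof.
apply/le_anti/andP; split.
  by rewrite himpP -[Order.meet _ _]/(val (Order.meet (himp x y) x)) -sl_leE
             -himpP.
have Sxy : sl_set S (himp (val x) (val y)) by apply/sl_himp/sl_valP.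
by rewrite -[X in X <= _]/(val (sl_elt Sxy)) -sl_leE himpP sl_leE/= -himpP.
Qed.

Lemma restr_inf (T : sublocale L) A :
  A `<=` [set x | sl_set T (val x)] ->
  [set x : sl_type S | sl_set T (val x)] (inf A).
Proof.
move=> AT; rewrite -[_ (inf A)]/(sl_set T (val (inf A))) val_inf.
by apply: sl_inf => _ [x /AT + <-].
Qed.

Lemma restr_himp (T : sublocale L) x y :
  [set x : sl_type S | sl_set T (val x)] y ->
  [set x : sl_type S | sl_set T (val x)] (himp x y).
Proof. move=> Ty; rewrite -[_ (himp x y)]/(sl_set T (val (himp x y))) val_himp.
by apply: sl_himp. Qed.

(* For [T `<=` S] this is [T] itself, viewed as a sublocale of [S]. *)
Definition restr (T : sublocale L) : sublocale (sl_type S) :=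
  Sublocale (@restr_inf T) (@restr_himp T).

End SublocaleLocale.

Section NowhereDense.
Context {d : Order.disp_t} {L : localeType d}.
Implicit Types (S T N F : sublocale L).

(* In the definitions indexed by two sublocales, the ambient one is [S]. *)
Definition nowhere_dense_in S N := N `<=` S /\ nowhere_dense (restr S N).

Definition max_nowhere_dense N :=
  nowhere_dense N /\
  ~ exists S : sublocale L, nowhere_dense S /\ nowhere_dense_in S N.

Definition regular_closed_in S T := T `<=` S /\ regular_closed (restr S T).

Definition hom_max_nowhere_dense N :=
  [/\ is_closed N, nowhere_dense N &
      forall T, regular_closed_in N T -> ~ is_void T -> max_nowhere_dense T].

(* The closure of [T] in the locale [S], pushed forward to a subset of [L]. *)
Definition closure_in S T : set L := [set val x | x in sl_closure (restr S T)].

Definition inaccessible S T :=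
  T `<=` S /\
  forall N, nowhere_dense_in (sl_supplement S) N ->
    is_void (sl_meet T (sl_closure N)).

Definition almost_inaccessible S T :=
  T `<=` S /\
  forall N, nowhere_dense_in (sl_supplement S) N ->
    T `<=` closure_in S (sl_meet S (sl_supplement (sl_closure N))).

End NowhereDense.

(* Main.v *)
Require Import Defs.
From mathcomp Require Import all_boot all_order.
From mathcomp Require Import boolp classical_sets.

Set Implicit Arguments.
Unset Strict Implicit.
Unset Printing Implicit Defensive.

Import Order.TTheory.

Local Open Scope order_scope.
Local Open Scope classical_set_scope.

(** A sublocale [N] contains its least element [n = inf N], and all the notions
involved depend only on such least elements: [N] is nowhere dense iff [n] is
dense ([n* = 0]), [N] is nowhere dense in [S] iff it lies in [S] and
[n -> s = s] with [s = inf S], and [N] is maximal nowhere dense iff [n] is dense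
and no dense [s <= n] satisfies [n -> s = s].  For [F = c(f)] with [f] dense,
almost inaccessibility says that [n -> f = f], and inaccessibility that
[n \/ f = 1], for every dense [n] with [f -> n = n].  The key step is that for
such an [n] the elements [m = n \/ f] and [s = n /\ f] are dense and satisfy
[m -> s = (n -> f) /\ (f -> n) = s], so that maximality of [c(m)] forces
[m = 1]. *)

(** * Heyting implication and dense elements *)

Section Heyting.
Context {d : Order.disp_t} {L : localeType d}.
Implicit Types (x y z a b : L).

Lemma himp_mp x y : Order.meet (himp x y) x <= y.
Proof. by rewrite -himpP. Qed.

Lemma le_himp x y : y <= himp x y.
Proof. by rewrite himpP leIl. Qed.

Lemma himp_eq1 x y : himp x y = \top <-> x <= y.
Proof.
by split=> [e|xy]; [rewrite -(meet1x x) -himpP e|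
  apply/le_anti; rewrite lex1 himpP meet1x].
Qed.

Lemma le_himpr x y z : y <= z -> himp x y <= himp x z.
Proof. by move=> yz; rewrite himpP; apply: le_trans yz; apply: himp_mp. Qed.

Lemma le_himpl x y z : x <= y -> himp y z <= himp x z.
Proof.
by move=> xy; rewrite himpP; apply: le_trans (himp_mp y z); apply: leI2.
Qed.

Lemma himpI x y z :
  himp x (Order.meet y z) = Order.meet (himp x y) (himp x z).
Proof.
apply/le_anti/andP; split; first by rewrite lexI !le_himpr// (leIl, leIr).
by rewrite himpP lexI; apply/andP; split; rewrite -himpP ?leIl ?leIr.
Qed.

Lemma himpxx x : himp x x = \top.
Proof. exact/himp_eq1. Qed.

Lemma himpK x y : himp x (himp x y) = himp x y.
Proof.
apply/le_anti; rewrite le_himp andbT himpP.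
by rewrite -[X in Order.meet _ X]meetxx meetA -himpP; apply: himp_mp.
Qed.

Lemma meet_himp x y : Order.meet x (himp x y) = Order.meet x y.
Proof.
apply/le_anti; rewrite !lexI !leIl/= meetC himp_mp/=.
by rewrite meetC (le_trans (leIl _ _)) ?le_himp.
Qed.

Lemma himp_join x y z :
  himp (Order.join x y) z = Order.meet (himp x z) (himp y z).
Proof.
apply/le_anti/andP; split; first by rewrite lexI !le_himpl// (leUl, leUr).
rewrite himpP meetC -himpP leUx !himpP; apply/andP; split; rewrite meetC -himpP.
  exact: leIl.
exact: leIr.
Qed.

(** The left side splits as (x -> x /\ y) /\ (y -> x /\ y) = (x -> y) /\ (y -> x). The hypothesis
    turns this into (x -> y) /\ x = x /\ y. *)
Lemma himp_join_meet x y : himp y x = x ->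
  himp (Order.join x y) (Order.meet x y) = Order.meet x y.
Proof.
by move=> yx; rewrite himp_join !himpI !himpxx meet1x meetx1 yx meetC meet_himp.
Qed.

Lemma himp_cover x y : Order.join x y = \top -> himp x y = y.
Proof.
move=> xy; have := himp_join x y y; rewrite xy himpxx meetx1 => <-.
by apply/le_anti; rewrite le_himp andbT -[X in X <= _]meetx1 himp_mp.
Qed.

Lemma dense_le x y : x <= y -> pcompl x = \bot -> pcompl y = \bot.
Proof.
by move=> xy x0; apply/le_anti; rewrite le0x andbT -x0 le_himpl.
Qed.

Lemma dense_meet x y :
  pcompl x = \bot -> pcompl y = \bot -> pcompl (Order.meet x y) = \bot.
Proof.
move=> x0 y0; apply/le_anti; rewrite le0x andbT -x0 himpP -y0 himpP -meetA.
exact: himp_mp.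
Qed.

Lemma dense_join_pcompl x : pcompl (Order.join x (pcompl x)) = \bot.
Proof.
rewrite /pcompl himp_join meetC; apply/le_anti; rewrite le0x andbT.
exact: himp_mp.
Qed.

End Heyting.

(** * Least elements, supplements, boundaries and density *)

Section LeastElements.
Context {d : Order.disp_t} {L : localeType d}.
Implicit Types (S T N F : sublocale L) (x a f n : L).

Lemma inf_in S : sl_set S (inf S).
Proof. exact: sl_inf. Qed.

Lemma inf_closed a : inf (sl_closed a) = a.
Proof.
by apply/le_anti/andP; split; [exact/inf_lb/lexx|apply: inf_ge => x].
Qed.

Lemma inf_open a : inf (sl_open a) = pcompl a.
Proof.
apply/le_anti/andP; split; first by apply: inf_lb; exists \bot.
by apply: inf_ge => _ [x _ <-]; apply/le_himpr/le0x.
Qed.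

Lemma sl_openP a x : sl_set (sl_open a) x <-> himp a x = x.
Proof. by split=> [[y _ <-]|ax]; [rewrite himpK|exists x]. Qed.

Lemma is_voidP S : is_void S <-> inf S = \top.
Proof.
split=> [S1|S1].
  by have : [set \top] (inf S) by rewrite -S1; apply: inf_in.
apply/seteqP; split=> [x Sx|_ ->]; last exact: sl_top.
by apply/le_anti; rewrite lex1 -S1 inf_lb.
Qed.

(** The witness is c(x) intersected with S, since c(x) itself need not lie in S. With S = o(f) it
    turns an element n with f -> n = n into a sublocale of o(f). *)
Lemma exists_sub_inf S x :
  sl_set S x -> exists2 N : sublocale L, N `<=` S & inf N = x.
Proof.
move=> Sx; exists (sl_meet (sl_closed x) S); first by rewrite sl_meetE => y [].
rewrite sl_meetE; apply/le_anti/andP; split; last by apply: inf_ge => y [].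
by apply: inf_lb; split=> //; apply: lexx.
Qed.

Lemma sl_interior_open a : (sl_interior (sl_open a) : set L) = sl_open a.
Proof.
apply/seteqP; split=> x; last first.
  by move=> ax U /(_ (sl_open a)); apply=> //; split=> //; exists a.
by apply=> O [].
Qed.

(** Every x decomposes as (a \/ x) /\ (a -> x). Here and below sublocales are compared by carriers,
    since closures and supplements are only known up to equality of carriers. *)
Lemma sl_join_closed_open a S T : (S : set L) = sl_closed a ->
  (T : set L) = sl_open a -> forall x, sl_set (sl_join S T) x.
Proof.
move=> Sa Ta x; apply/sl_joinP.
exists (Order.join a x), (himp a x); split.
- by rewrite Sa; apply: leUl.
- by rewrite Ta; exists x.
- apply/le_anti; rewrite lexI leUr le_himp/= -himpP leUx le_himp andbT.
  by rewrite himpP meetC himp_mp.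
Qed.

Lemma sl_supplement_open a S : (S : set L) = sl_open a ->
  (sl_supplement S : set L) = sl_closed a.
Proof.
move=> Sa; apply/seteqP; split=> x.
  apply; apply/seteqP; split=> // y _ U [SU aU].
  exact: (@sl_join_closed_open a (sl_closed a) S).
(* Minimality: if x = s /\ t with s in o(a), then a <= x <= s forces s = a -> s = 1, so x = t. *)
move=> /= ax T /seteqP[_ /(_ x I)] /sl_joinP[s [t [Ss Tt xE]]].
have {}Ss : himp a s = s by apply/sl_openP; rewrite -Sa.
have s1 : s = \top.
  by rewrite -Ss; apply/himp_eq1/(le_trans ax); rewrite xE leIl.
by rewrite xE s1 meet1x.
Qed.

Lemma sl_supplement_closed a S : (S : set L) = sl_closed a ->
  (sl_supplement S : set L) = sl_open a.
Proof.
move=> Sa; apply/seteqP; split=> x.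
  apply; apply/seteqP; split=> // y _ U [SU aU].
  exact: (@sl_join_closed_open a S (sl_open a)).
(* Here a <= s, so x = a -> x = (a -> s) /\ (a -> t) = a -> t. *)
move=> ox T /seteqP[_ /(_ x I)] /sl_joinP[s [t [Ss Tt xE]]].
have /himp_eq1 as1 : a <= s by move: Ss; rewrite Sa.
by move/sl_openP: ox; rewrite xE himpI as1 meet1x => <-; apply: sl_himp.
Qed.

Lemma sl_boundary_open a :
  (sl_boundary (sl_open a) : set L) = sl_closed (Order.join a (pcompl a)).
Proof.
rewrite sl_meetE sl_closureE inf_open.
rewrite (sl_supplement_open (sl_interior_open a)).
apply/seteqP; split=> x /=; first by move=> [xa ax]; rewrite leUx ax xa.
by rewrite leUx => /andP[].
Qed.

Lemma inf_congr S T : (S : set L) = T -> inf S = inf T.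
Proof. by move=> ->. Qed.

Lemma inf_boundary_open a :
  inf (sl_boundary (sl_open a)) = Order.join a (pcompl a).
Proof. by rewrite (inf_congr (sl_boundary_open a)) inf_closed. Qed.

Lemma nowhere_denseP S : nowhere_dense S <-> pcompl (inf S) = \bot.
Proof.
split=> [S1|s0].
  (* With [s = inf S], the element [s* -> s = s**] lies both in [S] and in the
     booleanization, hence is [1]. *)
  set s := inf S; have ssE : himp (pcompl s) s = pcompl (pcompl s).
    apply/le_anti/andP; split; last exact/le_himpr/le0x.
    rewrite himpP -[X in Order.meet _ X]meetxx meetA.
    by apply: le_trans (leI2 (himp_mp _ _) (lexx _)) _; rewrite meetC himp_mp.
  have : [set \top] (pcompl (pcompl s)).
    rewrite -S1; split; last by exists (pcompl s).
    by rewrite -ssE; apply/sl_himp/inf_in.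
  by move=> /himp_eq1; rewrite lex0 => /eqP.
apply/seteqP; split=> [y [Sy [x _ xE]]|_ ->]; last first.
  by split; [apply: sl_top|exists \bot => //; apply: himpxx].
rewrite -xE in Sy *.
have x0 : x = \bot.
  apply/le_anti; rewrite le0x andbT -s0 himpP meetC -himpP.
  exact: (@inf_lb _ _ (S : set L)).
by rewrite x0; apply: himpxx.
Qed.

End LeastElements.

(** * Maximality and inaccessibility through least elements *)

Section RelativeNotions.
Context {d : Order.disp_t} {L : localeType d}.
Implicit Types (S T N F : sublocale L) (x a f n : L).

Lemma val_inf_restr S N : N `<=` S -> val (inf (restr S N)) = inf N.
Proof.
move=> NS; rewrite val_inf; congr inf.
apply/seteqP; split=> [_ [x Nx <-]//|x Nx].
by exists (sl_elt (NS _ Nx)).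
Qed.

Lemma nowhere_dense_inP S N :
  nowhere_dense_in S N <-> N `<=` S /\ himp (inf N) (inf S) = inf S.
Proof.
have botE : val (\bot : sl_type S) = inf S.
  by rewrite -[\bot]/(slt_bot S) /= setIT.
split=> [] [NS]; [move=> /nowhere_denseP ND|move=> ND]; split=> //.
  have := congr1 val ND; rewrite /pcompl val_himp val_inf_restr//.
  by rewrite botE.
apply/nowhere_denseP/val_inj; rewrite /pcompl val_himp val_inf_restr//.
by rewrite botE.
Qed.

Definition max_dense n :=
  pcompl n = \bot /\
  forall s, pcompl s = \bot -> s <= n -> himp n s <> s.

(** Closed sublocales suffice to refute maximality: c(s) contains N as soon as s <= inf N, and its
    least element is s. *)
Lemma max_nowhere_denseP N : max_nowhere_dense N <-> max_dense (inf N).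
Proof.
split=> [[/nowhere_denseP n0 Nmax]|[n0 nmax]]; split=> //.
- move=> s s0 sn nsE; apply: Nmax; exists (sl_closed s).
  split; first by apply/nowhere_denseP; rewrite inf_closed.
  apply/nowhere_dense_inP; rewrite inf_closed; split=> // x /inf_lb.
  exact: le_trans.
- exact/nowhere_denseP.
- move=> [S [/nowhere_denseP s0 /nowhere_dense_inP[NS nsE]]].
  by apply: nmax s0 _ nsE; apply/inf_lb/NS/inf_in.
Qed.

Lemma supplement_nowhere_denseP f F N : (F : set L) = sl_closed f ->
  pcompl f = \bot ->
  nowhere_dense_in (sl_supplement F) N <->
  N `<=` sl_open f /\ pcompl (inf N) = \bot.
Proof.
move=> Ff f0; rewrite nowhere_dense_inP (sl_supplement_closed Ff).
by rewrite inf_open f0.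
Qed.

(** The intersection of c(f) with the closure of N is c(inf N \/ f), which is void exactly when inf
    N \/ f = 1. *)
Lemma inaccessibleP f F : (F : set L) = sl_closed f -> pcompl f = \bot ->
  inaccessible F F <->
  forall n, pcompl n = \bot -> himp f n = n -> Order.join n f = \top.
Proof.
move=> Ff f0; split=> [[_ Facc] n n0 fn|Facc]; last split=> // N.
  have /sl_openP/exists_sub_inf[N No nE] := fn.
  have /(supplement_nowhere_denseP _ Ff f0)/Facc :
      N `<=` sl_open f /\ pcompl (inf N) = \bot by rewrite nE.
  rewrite /is_void sl_meetE sl_closureE Ff nE => /seteqP[+ _]; apply.
  by split; rewrite /= (leUl, leUr).
move=> /(supplement_nowhere_denseP _ Ff f0)[No n0].
apply/is_voidP/le_anti; rewrite lex1 andTb -(Facc _ n0);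
  last exact/sl_openP/No/inf_in.
rewrite sl_meetE sl_closureE Ff leUx.
by apply/andP; split; apply: inf_ge => x [].
Qed.

Lemma closure_inE F S : S `<=` F ->
  closure_in F S = F `&` sl_closed (inf S).
Proof.
move=> SF; rewrite /closure_in sl_closureE.
apply/seteqP; split=> [_ [x /= sx <-]|x [Fx sx]].
  by split; [apply: sl_valP|move: sx; rewrite sl_leE val_inf_restr].
by exists (sl_elt Fx) => //=; rewrite sl_leE val_inf_restr.
Qed.

Lemma inf_closed_meet_supplement f n S T : (S : set L) = sl_closed f ->
  (T : set L) = sl_closed n -> inf (sl_meet S (sl_supplement T)) = himp n f.
Proof.
move=> Sf Tn; rewrite sl_meetE (sl_supplement_closed Tn) Sf.
apply/le_anti/andP; split.
  by apply: inf_lb; split; [apply: le_himp|exists f].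
by apply: inf_ge => x [/= fx /sl_openP <-]; apply: le_himpr.
Qed.

(** The relative closure is the part of F above n -> f, where n = inf N. It is all of F exactly when
    it contains f, that is, when n -> f <= f. *)
Lemma almost_inaccessibleP f F : (F : set L) = sl_closed f ->
  pcompl f = \bot ->
  almost_inaccessible F F <->
  forall n, pcompl n = \bot -> himp f n = n -> himp n f = f.
Proof.
move=> Ff f0.
have clE N : closure_in F (sl_meet F (sl_supplement (sl_closure N))) =
             F `&` sl_closed (himp (inf N) f).
  rewrite closure_inE; last by rewrite sl_meetE => x [].
  by rewrite (inf_closed_meet_supplement Ff (sl_closureE N)).
split=> [[_ Facc] n n0 fn|Facc]; last split=> // N.
  have /sl_openP/exists_sub_inf[N No nE] := fn.
  have /(supplement_nowhere_denseP _ Ff f0)/Facc :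
      N `<=` sl_open f /\ pcompl (inf N) = \bot by rewrite nE.
  rewrite clE nE Ff => /(_ f (lexx f))[_ nf].
  by apply/le_anti; rewrite nf le_himp.
move=> /(supplement_nowhere_denseP _ Ff f0)[No n0].
rewrite clE Facc//; last exact/sl_openP/No/inf_in.
by rewrite Ff => x.
Qed.

End RelativeNotions.

(** * The cycle of implications *)

Theorem theorem4p18 (d : Order.disp_t) (L : localeType d) :
  [<-> forall N : sublocale L,
         nowhere_dense N -> ~ is_void N -> max_nowhere_dense N;
       forall N : sublocale L,
         is_closed N -> nowhere_dense N -> ~ is_void N -> max_nowhere_dense N;
       forall x : L, ~ complemented x -> ~ is_void (sl_open x) ->
         max_nowhere_dense (sl_boundary (sl_open x));
       forall N : sublocale L,
         is_closed N -> nowhere_dense N -> ~ is_void N -> hom_max_nowhere_dense N;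
       forall F : sublocale L,
         is_closed F -> nowhere_dense F -> ~ is_void F -> almost_inaccessible F F;
       forall F : sublocale L,
         is_closed F -> nowhere_dense F -> ~ is_void F -> inaccessible F F].
Proof.
have closed_caseE (P : sublocale L -> Prop) :
    (forall F, is_closed F -> nowhere_dense F -> ~ is_void F -> P F) <->
    (forall (f : L) (F : sublocale L), (F : set L) = sl_closed f ->
      pcompl f = \bot -> f <> \top -> P F).
  split=> PF => [f F Ff f0 f1|F [f Ff]].
    have fE : inf F = f by rewrite (inf_congr Ff) inf_closed.
    apply: PF; [by exists f|by apply/nowhere_denseP; rewrite fE|].
    by move=> /is_voidP; rewrite fE.
  move=> /nowhere_denseP f0 F1; move: f0 F1; rewrite is_voidP.
  by rewrite (inf_congr Ff) inf_closed; apply: PF.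
have maxdenseE :
    (forall N : sublocale L, nowhere_dense N -> ~ is_void N ->
      max_nowhere_dense N) <->
    (forall n : L, pcompl n = \bot -> n <> \top -> max_dense n).
  split=> H => [n n0 n1|N /nowhere_denseP N0 N1].
    rewrite -(inf_closed n); apply/max_nowhere_denseP/H.
      by apply/nowhere_denseP; rewrite inf_closed.
    by move/is_voidP; rewrite inf_closed.
  by apply/max_nowhere_denseP/H => // /is_voidP.
tfae.
- by move=> H N _; apply: H.
(* The boundary of o(x) is c(x \/ [pcompl x]), non-void because x is not complemented. *)
- move=> /closed_caseE H x xc _; apply: H (sl_boundary_open x) _ xc.
  exact: dense_join_pcompl.
- move=> H N Nc N0 N1; split=> // T [TN _] T1; apply/max_nowhere_denseP.
  have t0 : pcompl (inf T) = \bot.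
    move/nowhere_denseP: N0; apply: dense_le.
    exact/inf_lb/TN/inf_in.
  (* As t = inf T is dense, the boundary of o(t) has the same least element t as T. *)
  have := H (inf T); rewrite max_nowhere_denseP inf_boundary_open t0 joinx0.
  apply; first by rewrite /complemented t0 joinx0 => /is_voidP.
  move=> /is_voidP; rewrite inf_open t0 => e; apply/T1/is_voidP.
  by apply/le_anti; rewrite lex1 -e le0x.
- move=> /closed_caseE H; apply/closed_caseE => f F Ff f0 f1.
  apply/(almost_inaccessibleP Ff f0) => n n0 fn; apply: himp_cover.
  apply: contrapT => m1; pose m := Order.join n f.
  have m0 : pcompl m = \bot by apply: dense_le n0; apply: leUl.
  have mE : inf (sl_closed m) = m by rewrite inf_closed.
  have [_ _ /(_ (sl_closed m))] := H m (sl_closed m) erefl m0 m1.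
  (* c(m) is the closure of its own largest open sublocale o(1). *)
  have mr : regular_closed_in (sl_closed m) (sl_closed m).
    split=> //; exists (sl_open \top).
      by exists \top.
    rewrite sl_closureE inf_open; apply/seteqP; split=> x _; last first.
      exact: (sl_valP x).
    by apply: le_trans (le0x x); rewrite -[X in X <= _]meetx1; apply: himp_mp.
  move=> /(_ mr); rewrite is_voidP max_nowhere_denseP mE => /(_ m1)[_].
  apply; [exact: dense_meet n0 f0|exact: (le_trans (leIl _ _) (leUl _ _))|].
  exact: himp_join_meet.
- move=> /closed_caseE H; apply/closed_caseE => f F Ff f0 f1.
  apply/(inaccessibleP Ff f0) => n n0 fn; apply: contrapT => m1.
  pose m := Order.join n f; pose s := Order.meet n f.
  have m0 : pcompl m = \bot by apply: dense_le n0; apply: leUl.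
  (* Almost inaccessibility is applied to c(m) rather than c(f) and tested at s: since m -> s = s,
     it gives s -> m = m, while s <= m gives s -> m = 1. *)
  have /(almost_inaccessibleP (erefl _) m0) := H m (sl_closed m) erefl m0 m1.
  move=> /(_ s (dense_meet n0 f0) (himp_join_meet fn)) smE.
  apply: m1; rewrite -/m -smE.
  exact/himp_eq1/(le_trans (leIl _ _))/leUl.
- move=> /closed_caseE H; apply/maxdenseE => n n0 n1; split=> // s s0 sn nsE.
  (* Inaccessibility of c(n) tested at s gives s \/ n = 1, and s <= n then makes n = 1. *)
  have /(inaccessibleP (erefl _) n0)/(_ s s0 nsE) :=
    H n (sl_closed n) erefl n0 n1.
  by move/join_idPl: sn; rewrite joinC => ->.
Qed.
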